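(* Fix integers $k,N\ge1$. For each integer $n\ge N+1$, let $p_{k,N}(n)$ denote the probability that a (uniformly random) $k$-tuple of functions between $k$ sets of cardinality $n$ is eventually $N$-cyclic. Then $$p_{k,N}(n)=\frac1N\,n^{-k(N-1)}\left(\frac{(n-1)!}{(n-N)!}\right)^k\left(1-\left(1-\frac Nn\right)^k\right),$$ and, as $n\to\infty$, $$p_{k,N}(n)=\frac kn+\mathcal O\left(\frac1{n^2}\right).$$
   Context: The $k$ sets $X_1,\dots,X_k$ are pairwise disjoint, indices are modulo $k$, and a $k$-tuple of functions means $(f_1,\dots,f_k)$ with $f_i:X_i\to X_{i+1}$ ($X_{k+1}=X_1$); there are $n^{kn}$ such tuples and $p_{k,N}(n)$ is the proportion that are eventually $N$-cyclic. The tuple is eventually $N$-cyclic if the iterated images $(f_k\cdots f_1)^m(X_1)$ eventually stabilize (for large $m$) to a subset of $X_1$ of cardinality $N$ on which $f_k\cdots f_1$ acts as an $N$-cycle (a single cyclic permutation of all $N$ elements). *)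

(* Defs.v *)
From HB Require Import structures.
From mathcomp Require Import all_boot all_order all_algebra.
From mathcomp Require Import all_classical all_reals all_analysis.

Set Implicit Arguments.
Unset Strict Implicit.
Unset Printing Implicit Defensive.

Import Order.TTheory GRing.Theory Num.Theory.
Import numFieldNormedType.Exports.

Local Open Scope ring_scope.

(* The k sets are the fibres of a family [X : 'I_k -> finType], numbered from  *)
(* 0 and hence disjoint by construction; [ordS] is i |-> i + 1 modulo k.       *)
Definition fun_tuple (k : nat) (X : 'I_k -> finType) : finType :=
  {dffun forall i : 'I_k, {ffun X i -> X (ordS i)}}.

Lemma iter_ordS (k : nat) (i : 'I_k) : iter k (@ordS k) i = i.
Proof.
have E m : iter m (@ordS k) i = ((i + m) %% k)%N :> nat.
  elim: m => [|m IHm] /=; first by rewrite addn0 modn_small.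
  by rewrite IHm -addn1 modnDml addn1 addnS.
by apply: val_inj; rewrite /= E modnDr modn_small.
Qed.

Fixpoint partial_comp (k : nat) (X : 'I_k -> finType) (f : fun_tuple X)
    (i : 'I_k) (m : nat) : X i -> X (iter m (@ordS k) i) :=
  if m is m'.+1 then fun x => f _ (partial_comp f m' x) else fun x => x.

(* For i the first index this is f_k \o ... \o f_1 : X_1 -> X_1.               *)
Definition round_trip (k : nat) (X : 'I_k -> finType) (f : fun_tuple X)
    (i : 'I_k) (x : X i) : X i :=
  ecast j (X j) (iter_ordS i) (partial_comp f k x).

Definition acts_as_cycle (T : finType) (g : T -> T) (A : {set T}) : Prop :=
  exists2 c : seq T, ufcycle g c & A = [set x in c]%SET.

Definition map_eventually_cyclic (T : finType) (N : nat) (g : T -> T) : Prop :=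
  exists A : {set T},
    [/\ exists m0 : nat, forall m : nat, (m0 <= m)%N ->
          iter m g @: [set: T]%SET = A,
        #|A| = N
      & acts_as_cycle g A].

Definition eventually_cyclic (k : nat) (hk : (0 < k)%N) (X : 'I_k -> finType)
    (N : nat) (f : fun_tuple X) : Prop :=
  map_eventually_cyclic N (@round_trip k X f (Ordinal hk)).

Definition prob_eventually_cyclic (R : realType) (k : nat) (hk : (0 < k)%N)
    (X : 'I_k -> finType) (N : nat) : R :=
  #|[set f : fun_tuple X | `[< eventually_cyclic hk N f >]]%SET|%:R
    / #|{: fun_tuple X}|%:R.

(* Main.v *)
(* Number every [X_i] by ['I_n], so that a tuple becomes one map [step h] on    *)
(* ['I_k * 'I_n].  The tuple is eventually N-cyclic iff [step h] has exactly    *)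
(* one cycle, of length [k N]; marking one of the N points of the cycle in the  *)
(* first set amounts to choosing [k] injections ['I_N -> 'I_n] listing the      *)
(* cycle.  With [A] the set of points listed, it remains to count the maps that *)
(* follow the list on [A] and whose orbits all reach [A].  For one map, the     *)
(* indicator of the latter condition is [\det (1 - Q)], [Q] being the 0/1       *)
(* matrix of the map restricted to the complement of [A].  As the determinant   *)
(* is multilinear in the rows and the values of the map are independent,        *)
(* summing over maps gives a single determinant, whose matrix has rank-[k]      *)
(* off-diagonal part; Sylvester's identity reduces it to a [k * k] cyclic one,  *)
(* with value [1 - (1 - N / n) ^ k] up to a power of [n].                       *)

Require Import Defs.
From HB Require Import structures.
From mathcomp Require Import all_boot all_order all_algebra.
From mathcomp Require Import fingroup perm zify ring.
From mathcomp Require Import all_classical all_reals all_analysis.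

Set Implicit Arguments.
Unset Strict Implicit.
Unset Printing Implicit Defensive.

Import Order.TTheory GRing.Theory Num.Theory.
Import numFieldNormedType.Exports.

(** The proof counts pairs (map, code) twice, a code being [k] injections ['I_N -> 'I_n]. For a
    fixed map, the codes it traces correspond to the attracting cycle points of its return map
    ([card_traced]): there are [N] of them if that map is eventually [N]-cyclic
    ([map_eventually_cyclic_card]) and none otherwise ([cycle_point_eventually]). For a fixed code,
    the number of maps tracing it does not depend on the code ([card_traced_code], from
    [count_absorbed]): it is [n ^ (k * (n - N))] free choices times the probability
    [1 - (1 - N / n) ^ k] that all orbits reach the listed points. That probability is a
    determinant: [det_1B_absorbed] expresses reachability, [sum_det_rows] averages it, [det_1B_mulC]
    and [det_1B_cycle] evaluate it. The resulting formula is a polynomial in [1 / n] with zero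
    constant term and linear coefficient [k], which gives the asymptotics. *)

Section Determinants.

(** * Determinants of [1 - Q], and sums of determinants over all maps *)

Local Open Scope ring_scope.

Lemma det_1B_mulC (R : comNzRingType) m n (U : 'M[R]_(m, n)) (V : 'M[R]_(n, m)) :
  \det (1%:M - U *m V) = \det (1%:M - V *m U).
Proof.
(* Eliminating either diagonal block of [B] computes the same determinant in two ways. *)
pose B : 'M[R]_(m + n) := block_mx 1%:M U V 1%:M.
have B1 : B = block_mx 1%:M 0 V 1%:M *m block_mx 1%:M U 0 (1%:M - V *m U).
  by rewrite mulmx_block ?(mulmx0, mul0mx, mulmx1, mul1mx, addr0, add0r) addrC subrK.
have B2 : B = block_mx (1%:M - U *m V) U 0 1%:M *m block_mx 1%:M 0 V 1%:M.
  by rewrite mulmx_block ?(mulmx0, mul0mx, mulmx1, mul1mx, addr0, add0r) subrK.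
have := congr1 determinant B1.
by rewrite {1}B2 !det_mulmx !det_lblock !det_ublock !det1 !mul1r !mulr1.
Qed.

(* Only the corner entry lies off the triangle: [1 - c P = (1 - c S)(1 - c w e_0)] *)
(* with [S] the strict shift and [w = (1 - c S)^-1 e_max], [w_i = c ^ (k - 1 - i)]. *)
Lemma det_1B_cycle (R : comNzRingType) (k : nat) (c : R) : (0 < k)%N ->
  \det (1%:M - c *: \matrix_(i < k, j < k) (j == ordS i)%:R) = 1 - c ^+ k.
Proof.
case: k => // k _.
pose S : 'M[R]_k.+1 := \matrix_(i, j) (j == i.+1 :> nat)%:R.
pose w : 'cV[R]_k.+1 := \col_i c ^+ (k - i).
pose e : 'rV[R]_k.+1 := \row_j (j == 0)%:R.
have Sw i : ((1%:M - c *: S) *m w) i 0 = (i == ord_max)%:R.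
  rewrite mulmxBl mul1mx -scalemxAl !mxE.
  have [-> | ni] := eqVneq i ord_max.
    rewrite subnn big1 ?mulr0 ?subr0 // => j _.
    by rewrite !mxE /= ltn_eqF ?mul0r.
  have lti : (i < k)%N.
    by rewrite ltn_neqAle -ltnS ltn_ord andbT; apply: contra ni => /eqP E; apply/eqP/val_inj.
  rewrite (bigD1 (Ordinal (lti : i.+1 < k.+1)%N)) //= !mxE eqxx mul1r big1 => [|j nj].
    by rewrite addr0 -exprS -subSn // subSS subrr.
  rewrite !mxE; case: eqP => [E|]; rewrite ?mul0r //.
  by case/eqP: nj; apply: val_inj.
have -> : 1%:M - c *: \matrix_(i < k.+1, j < k.+1) (j == ordS i)%:R
    = (1%:M - c *: S) *m (1%:M - (c *: w) *m e).
  rewrite mulmxBr mulmx1 -scalemxAl -scalemxAr mulmxA -addrA -opprD -scalerDr.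
  congr (_ - _ *: _); apply/matrixP => i j.
  rewrite [RHS]mxE [X in _ + X]mxE big_ord_recl big_ord0 addr0 Sw !mxE.
  have [-> | ni] := eqVneq i ord_max.
    rewrite mul1r [j == k.+1 :> nat]ltn_eqF ?add0r //; congr (_ %:R).
    by rewrite -val_eqE /= modnn.
  have lti : (i < k)%N.
    by rewrite ltn_neqAle -ltnS ltn_ord andbT; apply: contra ni => /eqP E; apply/eqP/val_inj.
  by rewrite mul0r addr0 -val_eqE /= modn_small.
rewrite det_mulmx -det_tr det_trig; last first.
  apply/is_trig_mxP => i j ltij; rewrite !mxE -val_eqE gtn_eqF //.
  by rewrite ltn_eqF ?mulr0 ?subr0 // ltnS ltnW.
rewrite big1 => [|i _]; last by rewrite !mxE eqxx ltn_eqF // mulr0 subr0.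
(* The remaining factor is a rank-one perturbation of the identity, so Sylvester's identity leaves
   the scalar [1 - c * w_0]. *)
rewrite mul1r det_1B_mulC det_mx11 !mxE (bigD1 ord0) //= big1 => [|i ni].
  by rewrite !mxE eqxx mul1r subn0 addr0 exprS.
by rewrite !mxE (negPf ni) mul0r.
Qed.

Section MatrixOver.
Variables (R : comNzRingType) (T : finType).

Definition mx_of_fun (M : T -> T -> R) : 'M[R]_#|T| :=
  \matrix_(i, j) M (enum_val i) (enum_val j).

Lemma eq_mx_of_fun M M' : M =2 M' -> mx_of_fun M = mx_of_fun M'.
Proof. by move=> E; apply/matrixP=> i j; rewrite !mxE. Qed.

Lemma prod_enum_val (F : T -> R) : \prod_(i < #|T|) F (enum_val i) = \prod_x F x.
Proof. by rewrite -(big_enum_val F). Qed.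

Lemma sum_enum_val (F : T -> R) : \sum_(i < #|T|) F (enum_val i) = \sum_x F x.
Proof. by rewrite -(big_enum_val F). Qed.

Lemma det_scale_rows (d : T -> R) (M : T -> T -> R) :
  \det (mx_of_fun (fun x y => d x * M x y)) = (\prod_x d x) * \det (mx_of_fun M).
Proof.
have -> : mx_of_fun (fun x y => d x * M x y) = diag_mx (\row_i d (enum_val i)) *m mx_of_fun M.
  by apply/matrixP=> i j; rewrite mul_diag_mx !mxE.
rewrite det_mulmx det_diag -prod_enum_val; congr (_ * _).
by apply: eq_bigr => i _; rewrite mxE.
Qed.

(** Each Leibniz term takes one entry from every row, and row [x] sees [h] only through [h x]; hence
    the sum over [h] distributes over the product of entries. *)
Lemma sum_det_rows (W : finType) (G : T -> W -> T -> R) :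
  \sum_(h : {ffun T -> W}) \det (mx_of_fun (fun x y => G x (h x) y))
    = \det (mx_of_fun (fun x y => \sum_w G x w y)).
Proof.
rewrite /determinant exchange_big; apply: eq_bigr => s _ /=.
rewrite -mulr_sumr; congr (_ * _).
pose P x w := G x w (enum_val ((s : 'S_#|T|) (enum_rank x))).
transitivity (\sum_(h : {ffun T -> W}) \prod_x P x (h x)).
  by apply: eq_bigr => h _; rewrite -prod_enum_val; apply: eq_bigr => i _; rewrite mxE /P enum_valK.
rewrite -(bigA_distr_bigA P) -prod_enum_val.
by apply: eq_bigr => i _; rewrite mxE /P enum_valK.
Qed.

End MatrixOver.

(* If every point reaches [A], a non-identity permutation contributing to the *)
(* Leibniz expansion would contain a cycle of [f] avoiding [A]; otherwise the *)
(* indicator of the points that never reach [A] is in the kernel.             *)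
Lemma det_1B_absorbed (R : idomainType) (T : finType) (f : T -> T) (A : {set T}) :
  \det (mx_of_fun (fun x y => (x == y)%:R - ((x \notin A) && (y \notin A) && (f x == y))%:R : R))
  = [forall x, exists y in A, fconnect f x y]%:R.
Proof.
set M := fun x y => _.
pose reach x := [exists y in A, fconnect f x y].
have reachA x : x \in A -> reach x by move=> xA; apply/existsP; exists x; rewrite xA connect0.
have reach_f x : x \notin A -> reach (f x) = reach x.
  move=> xA; apply/existsP/existsP=> -[y /andP[yA c]]; exists y; rewrite yA /=.
    by rewrite (connect_trans (fconnect1 f x) c).
  by move: c; rewrite fconnect_eqVf => /predU1P[E|//]; rewrite E yA in xA.
have [/forallP ab|/forallPn[x0 nx0]] := boolP [forall x, reach x]; last first.
  (* [det0P] asks for a row vector killed on the left, whereas the indicator, being constant along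
     [f] outside [A], is killed on the right; hence the transpose. *)
  apply/eqP; rewrite -det_tr; apply/det0P.
  exists (\row_i (~~ reach (enum_val i))%:R).
    apply/eqP=> /rowP/(_ (enum_rank x0)); rewrite !mxE enum_rankK nx0.
    by move/eqP; rewrite oner_eq0.
  apply/rowP=> j; rewrite !mxE; set x := enum_val j.
  under eq_bigr => i _ do rewrite !mxE.
  rewrite (sum_enum_val (fun y => (~~ reach y)%:R * M x y)) /M.
  under eq_bigr => y _ do rewrite mulrBr.
  rewrite sumrB (bigD1 x) //= eqxx mulr1 big1 => [|y /negPf ny]; last by rewrite eq_sym ny mulr0.
  rewrite addr0 (bigD1 (f x)) //= eqxx andbT big1 => [|y /negPf ny]; last first.
    by rewrite [f x == y]eq_sym ny andbF mulr0.
  rewrite addr0; have [xA|xA] /= := boolP (x \in A).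
    by rewrite reachA // mulr0 subr0.
  rewrite reach_f //; case: (boolP (reach x)) => rx; rewrite ?mul0r ?subrr //=.
  rewrite mul1r; suff -> : f x \notin A by rewrite subrr.
  by apply: contra rx => /reachA; rewrite reach_f.
rewrite /determinant (bigD1 1%g) //= odd_perm1 expr0 mul1r.
have noloop x : x \notin A -> f x != x.
  move=> xA; apply/eqP=> E; have /existsP[y /andP[yA]] := ab x.
  move=> /iter_findex; rewrite iter_fix // => Exy.
  by rewrite Exy yA in xA.
rewrite big1 => [|i _]; last first.
  rewrite mxE perm1 /M eqxx; case: (boolP (_ \in A)) => [_|xA] /=; first by rewrite subr0.
  by rewrite (negPf (noloop _ xA)) subr0.
rewrite big1 ?addr0 // => s s_n1.
have [i0 si0] : exists i, s i != i.
  apply/existsP; rewrite -negb_forall; apply: contra s_n1 => /forallP H.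
  by apply/eqP/permP=> i; rewrite perm1; apply/eqP.
apply/eqP; rewrite mulf_eq0; apply/orP; right; apply/eqP/eqP/negPn/negP.
move/prodf_neq0 => nz.
(* At a moved index the entry is off-diagonal; being nonzero, it forces [s] to follow [f] between
   two points outside [A]. The whole [f]-orbit of [i0] then avoids [A]. *)
have orb m : let i := iter m s i0 in [&& s i != i, enum_val i \notin A & iter m f (enum_val i0) == enum_val i].
  elim: m => [|m /= IHm] /=.
    rewrite si0 eqxx andbT; apply/negP=> xA.
    have := nz i0 isT; rewrite mxE /M xA /= subr0.
    by rewrite (inj_eq enum_val_inj) [i0 == _]eq_sym (negPf si0) eqxx.
  case/and3P: IHm; set i := iter m s i0 => si iA /eqP->.
  have ssi : s (s i) != s i by rewrite (inj_eq perm_inj).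
  rewrite ssi /=; have := nz i isT.
  rewrite mxE /M (inj_eq enum_val_inj) [i == _]eq_sym (negPf si) sub0r oppr_eq0.
  by case: andP => [[/andP[_ ->] ->] //|_]; rewrite eqxx.
have /existsP[y /andP[yA /iter_findex]] := ab (enum_val i0).
case/and3P: (orb (findex f (enum_val i0) y)) => _ h /eqP-> E.
by rewrite E yA in h.
Qed.

(** * Counting the maps with prescribed values on [A] whose orbits all reach [A] *)

Definition step (k n : nat) (h : 'I_k * 'I_n -> 'I_n) (v : 'I_k * 'I_n) : 'I_k * 'I_n :=
  (ordS v.1, h v).

Lemma big_pair (S : Type) (idx : S) (op : Monoid.com_law idx) (I J : finType) (F : I * J -> S) :
  \big[op/idx]_x F x = \big[op/idx]_i \big[op/idx]_j F (i, j).
Proof. by rewrite pair_bigA; apply: eq_bigr => -[]. Qed.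

Lemma count_absorbed (R : numFieldType) (k n N : nat) (A : {set 'I_k * 'I_n})
    (nxt : 'I_k * 'I_n -> 'I_n) : (0 < k)%N -> (0 < n)%N -> (N <= n)%N ->
  (forall i, #|[set a | (i, a) \in A]| = N) ->
  #|[set h : {ffun 'I_k * 'I_n -> 'I_n} |
      [forall v in A, h v == nxt v] && [forall v, exists w in A, fconnect (step h) v w]]|%:R
  = n%:R ^+ (k * (n - N)) * (1 - (1 - N%:R / n%:R) ^+ k) :> R.
Proof.
move=> k0 n0 leNn cardA.
have nn0 : n%:R != 0 :> R by rewrite pnatr_eq0 -lt0n.
have cardAC i : #|[pred a | (i, a) \notin A]| = (n - N)%N.
  have := cardC [set a | (i, a) \in A]; rewrite card_ord cardA => E.
  apply/eqP; rewrite -(eqn_add2l N) subnKC //; apply/eqP; rewrite -[RHS]E.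
  by congr (_ + _)%N; apply: eq_card => a; rewrite !inE.
pose d (h : 'I_k * 'I_n -> 'I_n) x : R := if x \in A then (h x == nxt x)%:R else 1.
(* Row [x] of the determinant when [h x = w]; the constraint [h x = nxt x] on [A] enters as a row
   factor. *)
pose G x w y : R := if x \in A then (w == nxt x)%:R * (x == y)%:R
  else (x == y)%:R - ((y \notin A) && ((ordS x.1, w) == y))%:R.
(* After summation over [w], a row of [A] keeps its single admissible value, while any other row
   carries a factor [n]. *)
pose e x : R := if x \in A then 1 else n%:R.
rewrite -sum1_card natr_sum big_mkcond /=.
transitivity (\sum_(h : {ffun 'I_k * 'I_n -> 'I_n}) \det (mx_of_fun (fun x y => G x (h x) y))).
  apply: eq_bigr => h _; rewrite inE.
  transitivity ((\prod_x d h x) * [forall v, exists w in A, fconnect (step h) v w]%:R).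
    have -> : \prod_x d h x = [forall v in A, h v == nxt v]%:R.
      have [/forall_inP H|/forall_inPn[v vA hv]] := boolP [forall v in A, h v == nxt v].
        by rewrite big1 // => x _; rewrite /d; case: ifP => // xA; rewrite (eqP (H _ xA)) eqxx.
      by rewrite (bigD1 v) //= /d vA (negPf hv) mul0r.
    by rewrite -natrM mulnb; case: andb.
  rewrite -det_1B_absorbed -det_scale_rows; congr (\det _); apply: eq_mx_of_fun => x y.
  by rewrite /d /G /step; case: ifP => xA //=; rewrite ?mul1r ?subr0.
(* The averaged transition matrix depends only on the fibres of its two ends, so it factors through
   ['I_k]. In the product [V *m U], summing over the [n - N] points of a fibre outside [A] gives the
   coefficient [1 - N / n]. *)
pose U : 'M[R]_(#|{: 'I_k * 'I_n}|, k) :=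
  \matrix_(x, i) ((enum_val x \notin A) && ((enum_val x).1 == i))%:R.
pose V : 'M[R]_(k, #|{: 'I_k * 'I_n}|) :=
  \matrix_(i, y) (((enum_val y \notin A) && ((enum_val y).1 == ordS i))%:R / n%:R).
rewrite sum_det_rows.
transitivity ((\prod_x e x) * \det (1%:M - U *m V)).
  have -> : 1%:M - U *m V = mx_of_fun (fun x y =>
      (x == y)%:R - ((x \notin A) && (y \notin A) && (ordS x.1 == y.1))%:R / n%:R).
    apply/matrixP=> i j; rewrite !mxE (inj_eq enum_val_inj); congr (_ - _).
    rewrite (bigD1 (enum_val i).1) //= !mxE eqxx andbT big1 ?addr0 => [|l nl].
      by rewrite mulrA -natrM mulnb andbA [ordS _ == _]eq_sym.
    by rewrite !mxE [_ == l]eq_sym (negPf nl) andbF mul0r.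
  rewrite -det_scale_rows; congr (\det _); apply: eq_mx_of_fun => x y.
  rewrite /G /e; case: ifP => xA /=.
    rewrite mul0r subr0 mul1r -mulr_suml (bigD1 (nxt x)) //= eqxx big1 ?addr0 ?mul1r //.
    by move=> w /negPf->.
  rewrite sumrB sumr_const card_ord mulrBr mulrCA divff // mulr1 mulr_natl; congr (_ - _).
  rewrite (bigD1 y.2) //= big1 ?addr0 => [|w nw].
    by rewrite [y in (_, _) == y]surjective_pairing xpair_eqE eqxx andbT.
  by rewrite [y in (_, _) == y]surjective_pairing xpair_eqE (negPf nw) !andbF.
rewrite det_1B_mulC.
have -> : V *m U = (1 - N%:R / n%:R) *: \matrix_(i < k, j < k) (j == ordS i)%:R.
  apply/matrixP=> i j; rewrite !mxE.
  under eq_bigr => x _ do rewrite !mxE.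
  rewrite (sum_enum_val (fun x => ((x \notin A) && (x.1 == ordS i))%:R / n%:R * ((x \notin A) && (x.1 == j))%:R)).
  rewrite big_pair /= (bigD1 (ordS i)) //= [X in _ + X]big1 ?addr0 => [|l nl]; last first.
    by rewrite big1 // => a _; rewrite (negPf nl) andbF !mul0r.
  have [_ | _] := eqVneq j (ordS i); last first.
    by rewrite mulr0 big1 // => a _; rewrite andbF mulr0.
  have -> : 1 - N%:R / n%:R = (n - N)%:R / n%:R :> R by rewrite natrB // mulrBl divff.
  rewrite mulr1 -(cardAC (ordS i)) -sum1_card natr_sum.
  rewrite [in RHS]big_mkcond mulr_suml; apply: eq_bigr => a _.
  by rewrite inE eqxx !andbT; case: (_ \notin A); rewrite ?mulr1 ?mulr0 ?mul0r.
rewrite det_1B_cycle // big_pair /=; congr (_ * _).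
transitivity (\prod_(i < k) (n%:R ^+ (n - N) : R)).
  apply: eq_bigr => i _; rewrite -(cardAC i) -prodr_const [RHS]big_mkcond /=.
  by apply: eq_bigr => a _; rewrite /e inE; case: (_ \in A).
by rewrite prodr_const card_ord -exprM mulnC.
Qed.

End Determinants.

(** * Attracting cycles of a self-map of a finite set *)

Definition cycle_point (T : finType) (g : T -> T) (N : nat) (x : T) : bool :=
  [&& uniq (traject g x N), iter N g x == x & [forall y, fconnect g y x]].

Lemma cycle_iter_mul (T : Type) (g : T -> T) (N : nat) x m :
  iter N g x = x -> iter (N * m) g x = x.
Proof. by move=> E; elim: m => [|m IHm]; rewrite ?muln0 // mulnS iterD IHm. Qed.

Lemma mem_set_cycle_iter (T : finType) (g : T -> T) (N : nat) x m :
  (0 < N)%N -> iter N g x = x -> x \in iter m g @: [set: T]%SET.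
Proof.
move=> N0 E; apply/imsetP; exists (iter (N * m - m) g x); rewrite ?inE //.
by rewrite -iterD subnKC ?leq_pmull // cycle_iter_mul.
Qed.

(** The cycle points are exactly the limit set: periodic points survive in every iterated image, and
    conversely every orbit enters the limit cycle and so meets each of its points. *)
Lemma map_eventually_cyclic_card (T : finType) (N : nat) (g : T -> T) :
  (0 < N)%N -> map_eventually_cyclic N g -> #|[set x | cycle_point g N x]%SET| = N.
Proof.
move=> N0 [A [[m0 stab] cardA [c /andP[cyc uc] defA]]].
rewrite -[RHS]cardA; apply: eq_card => x; rewrite inE; apply/idP/idP.
  case/and3P=> _ /eqP E _; rewrite -(stab m0) //.
  exact: mem_set_cycle_iter N0 E.
rewrite defA inE => xc.
have sc : size c = N by rewrite -cardA defA cardsE; apply/esym/card_uniqP.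
have ord_x : fingraph.order g x = N by rewrite (order_cycle cyc).
apply/and3P; split.
- by rewrite -ord_x orbit_uniq.
- by rewrite -ord_x (iter_order_cycle cyc).
apply/forallP=> y; apply: (connect_trans (fconnect_iter g m0 y)).
rewrite (fconnect_cycle cyc) //.
have : iter m0 g y \in A by rewrite -(stab m0) // imset_f ?inE.
by rewrite defA inE.
Qed.

Lemma cycle_point_eventually (T : finType) (N : nat) (g : T -> T) x :
  (0 < N)%N -> cycle_point g N x -> map_eventually_cyclic N g.
Proof.
move=> N0 /and3P[ux /eqP E /forallP conn].
have cyc : fcycle g (traject g x N).
  case: N N0 ux E => // M _ _ E.
  by rewrite /= -[X in rcons _ X]E iterSr -trajectSr fpath_traject.
have perN z : z \in traject g x N -> iter N g z = z.
  by case/trajectP=> i _ ->; rewrite -iterD addnC iterD E.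
exists [set y in traject g x N]%SET; split.
(* The first visit of any orbit to [x] happens in fewer than [#|T|] steps, so by then every orbit is
   on the cycle. *)
- exists #|T| => m lem; apply/setP=> z; rewrite inE; apply/imsetP/idP => [[y _ ->]|/perN Ez].
    have := conn y => c; have lt_m : (findex g y x <= m)%N.
      by rewrite (leq_trans (ltnW (findex_max c))) // (leq_trans _ lem) // max_card.
    rewrite -(subnK lt_m) iterD iter_findex //.
    have xt : x \in traject g x N by case: (N) N0 => // ? _; rewrite mem_head.
    by rewrite -(fconnect_cycle cyc xt) fconnect_iter.
  by apply/imsetP; apply: mem_set_cycle_iter N0 Ez.
- by rewrite cardsE (card_uniqP ux) size_traject.
- by exists (traject g x N) => //; apply/andP.
Qed.

(** * Listing the cycle of [step h] by [k] injections *)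

Section Codes.
Variables (k n N : nat) (k0 : (0 < k)%N) (N0 : (0 < N)%N).
Implicit Types (h : {ffun 'I_k * 'I_n -> 'I_n}) (c : {ffun 'I_k -> {ffun 'I_N -> 'I_n}}).
Let i0 := Ordinal k0.
Let t0 := Ordinal N0.

Definition return_map h (a : 'I_n) : 'I_n := (iter k (step h) (i0, a)).2.

(** The entry [c i t] stands for the point met in fibre [i] during round [t] of a cycle of length
    [k * N]. *)
Definition vertex c (j : 'I_k * 'I_N) : 'I_k * 'I_n := (j.1, c j.1 j.2).

(** The round number advances, modulo [N], only when the fibre index wraps around. *)
Definition next_entry c (j : 'I_k * 'I_N) : 'I_n :=
  c (ordS j.1) (if j.1.+1 == k then ordS j.2 else j.2).

Definition traced_by h c : bool :=
  [&& [forall i, injectiveb (c i)], [forall j, h (vertex c j) == next_entry c j]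
    & [forall v, exists j, fconnect (step h) v (vertex c j)]].

Lemma iter_step_fst h m v : (iter m (step h) v).1 = ((v.1 + m) %% k)%N :> nat.
Proof.
elim: m => [|m IHm] /=; first by rewrite addn0 modn_small.
by rewrite IHm -addn1 modnDml addn1 addnS.
Qed.

Lemma iter_return h s a : iter (k * s) (step h) (i0, a) = (i0, iter s (return_map h) a).
Proof.
elim: s => [|s IHs]; first by rewrite muln0.
rewrite mulnS iterD IHs iterS [LHS]surjective_pairing; congr (_, _).
by apply: val_inj; rewrite /= iter_step_fst /= add0n modnn.
Qed.

Let ordk m : 'I_k := Ordinal (ltn_pmod m k0).
Let ordN m : 'I_N := Ordinal (ltn_pmod m N0).

(** Time is read in mixed radix: the remainder of [m] modulo [k] is the fibre, the quotient modulo
    [N] is the round. *)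
Lemma iter_traced h c m : traced_by h c ->
  iter m (step h) (vertex c (i0, t0)) = vertex c (ordk m, ordN (m %/ k)).
Proof.
move=> /and3P[_ /forallP Hc _]; elim: m => [|m IHm].
  by congr (vertex c (_, _)); apply: val_inj; rewrite /= ?div0n mod0n.
rewrite iterS IHm /step (eqP (Hc _)) /next_entry /vertex /=.
have -> : ordS (ordk m) = ordk m.+1.
  by apply: val_inj; rewrite /= -addn1 modnDml addn1.
congr (_, c _ _); apply: val_inj; rewrite /=.
have E := divn_eq m k; have lt := ltn_pmod m k0.
case: eqP => [e|ne] /=.
  have -> : m.+1 = ((m %/ k).+1 * k)%N by rewrite mulSn {1}E -addnS e addnC.
  by rewrite mulnK // -addn1 modnDml addn1.
have -> : m.+1 = ((m %/ k) * k + (m %% k).+1)%N by rewrite addnS -E.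
have lt' : ((m %% k).+1 < k)%N by rewrite ltn_neqAle lt andbT; apply/eqP.
by rewrite divnMDl // (divn_small lt') addn0.
Qed.

Lemma traced_base h c t : traced_by h c ->
  iter t (return_map h) (c i0 t0) = c i0 (ordN t).
Proof.
move=> tr; have := iter_return h t (c i0 t0).
rewrite -[(i0, _)]/(vertex c (i0, t0)) iter_traced // mulKn // => -[_ <-].
by congr (c _ _); apply: val_inj; rewrite /= modnMr.
Qed.

(** A code traced by [h] is therefore determined by its base entry [c i0 t0], which makes the base
    entry injective on such codes. *)
Lemma traced_entry h c i (t : 'I_N) : traced_by h c ->
  c i t = (iter (i + k * t) (step h) (i0, c i0 t0)).2.
Proof.
move=> tr; rewrite -[(i0, _)]/(vertex c (i0, t0)) iter_traced //=.
have -> : ordk (i + k * t) = i.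
  by apply: val_inj; rewrite /= addnC mulnC modnMDl modn_small.
congr (c _ _); apply: val_inj; rewrite /= addnC mulnC divnMDl //.
by rewrite (divn_small (ltn_ord i)) addn0 modn_small.
Qed.

Lemma traced_cycle_point h c : traced_by h c -> cycle_point (return_map h) N (c i0 t0).
Proof.
move=> tr; have per : iter N (return_map h) (c i0 t0) = c i0 t0.
  by rewrite traced_base //; congr (c _ _); apply: val_inj; rewrite /= modnn.
have perF : iter (k * N) (step h) (i0, c i0 t0) = (i0, c i0 t0).
  by rewrite iter_return per.
case/and3P: (tr) => /forallP inj _ /forallP ab.
apply/and3P; split; [|exact/eqP|].
  apply/(uniqP (c i0 t0)) => s t; rewrite !inE !size_traject => ls lt.
  rewrite !nth_traject // !traced_base // => /(injectiveP _ (inj i0)) /(congr1 val).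
  by rewrite /= !modn_small.
apply/forallP=> b.
have /existsP[[i t] cj] := ab (i0, b).
have : fconnect (step h) (i0, b) (i0, c i0 t0).
  apply: (connect_trans cj); rewrite /vertex /= (traced_entry _ _ tr).
  set m := (i + k * t)%N; have lem : (m <= k * N)%N.
    by rewrite /m; have := ltn_ord i; have := ltn_ord t; nia.
  have -> : (i, (iter m (step h) (i0, c i0 t0)).2) = iter m (step h) (i0, c i0 t0).
    rewrite [RHS]surjective_pairing; congr (_, _); apply: val_inj.
    by rewrite /= iter_step_fst /= add0n /m addnC mulnC modnMDl modn_small.
  (* The [k * N - m] steps left in the lap lead back to the base point. *)
  by rewrite -{2}perF -(subnK lem) iterD fconnect_iter.
move=> /iter_findex; set m := findex _ _ _ => E.
(* Source and target lie in the same fibre, so the travel time is a multiple of [k] and amounts to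
   whole iterations of [return_map]. *)
have /eqP m0 : (m %% k)%N = 0%N by have := iter_step_fst h m (i0, b); rewrite E /= add0n.
move: E; rewrite -(divnK m0) mulnC iter_return => -[<-]; exact: fconnect_iter.
Qed.

Lemma cycle_point_traced h a : cycle_point (return_map h) N a ->
  exists2 c, traced_by h c & c i0 t0 = a.
Proof.
case/and3P=> u /eqP per /forallP conn.
pose c : {ffun 'I_k -> {ffun 'I_N -> 'I_n}} :=
  [ffun i : 'I_k => [ffun t : 'I_N => (iter (i + k * t) (step h) (i0, a)).2]].
have perF t : iter (k * (t + N)) (step h) (i0, a) = iter (k * t) (step h) (i0, a).
  by rewrite !iter_return iterD per.
have vE i (t : 'I_N) : vertex c (i, t) = iter (i + k * t) (step h) (i0, a).
  rewrite /vertex !ffunE [RHS]surjective_pairing; congr (_, _); apply: val_inj.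
  by rewrite /= iter_step_fst /= add0n addnC mulnC modnMDl modn_small.
have c0 : c i0 t0 = a by rewrite !ffunE muln0.
exists c => //; apply/and3P; split.
- apply/forallP=> i; apply/injectiveP=> s t E.
  (* Running both points to the end of a lap lands in the first fibre, at rounds [s] and [t] of an
     orbit without repetition. *)
  have : iter (k * N - i) (step h) (vertex c (i, s)) = iter (k * N - i) (step h) (vertex c (i, t)).
    by rewrite /vertex /= E.
  have li : (i <= k * N)%N by have := ltn_ord i; nia.
  rewrite !vE -!iterD !addnA !subnK // -!mulnDr ![(N + _)%N]addnC !perF !iter_return => -[] Est.
  have := nth_uniq a _ _ u; rewrite size_traject => /(_ s t (ltn_ord s) (ltn_ord t)).
  by rewrite !nth_traject // Est eqxx => /esym/eqP/val_inj.
- apply/forallP=> -[i t].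
  apply/eqP; rewrite -[LHS]/(step h (vertex c (i, t))).2 vE -iterS -addSn /next_entry !ffunE.
  rewrite [ordS _ : nat]/= [(i, t).1]/= [(i, t).2]/=; case: eqP => [e|ne].
    rewrite e modnn add0n -mulnS [ordS _ : nat]/=.
    have [lt|ge] := ltnP t.+1 N; first by rewrite modn_small.
    have -> : t.+1 = N by apply/eqP; rewrite eqn_leq ge ltn_ord.
    by rewrite modnn -{1}[N]add0n perF muln0.
  by rewrite modn_small // ltn_neqAle ltn_ord andbT; apply/eqP.
apply/forallP=> -[i b]; apply/existsP; exists (i0, t0); rewrite /vertex c0 /=.
(* After [k - i] steps the orbit is in the first fibre, where [conn] applies. *)
apply: (connect_trans (fconnect_iter _ (k - i) _)).
rewrite [iter _ _ _]surjective_pairing; set b' := _.2.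
have -> : (iter (k - i) (step h) (i, b)).1 = i0.
  by apply: val_inj; rewrite /= iter_step_fst /= subnKC ?modnn // ltnW.
by rewrite -(iter_findex (conn b')) -iter_return fconnect_iter.
Qed.

Lemma card_traced h :
  #|[set c | traced_by h c]%SET| = #|[set a | cycle_point (return_map h) N a]%SET|.
Proof.
rewrite -(@card_in_imset _ _ (fun c => c i0 t0)); last first.
  move=> c c'; rewrite !inE => tr tr' E; apply/ffunP=> i; apply/ffunP=> t.
  by rewrite (traced_entry _ _ tr) (traced_entry _ _ tr') E.
apply: eq_card => a; rewrite inE; apply/imsetP/idP => [[c]|/cycle_point_traced[c tr <-]].
  by rewrite inE => tr ->; apply: traced_cycle_point.
by exists c; rewrite ?inE.
Qed.

Local Open Scope ring_scope.

Lemma card_traced_code (R : numFieldType) c : (0 < n)%N -> (N <= n)%N ->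
  (forall i, injective (c i)) ->
  #|[set h | traced_by h c]%SET|%:R
  = n%:R ^+ (k * (n - N)) * (1 - (1 - N%:R / n%:R) ^+ k) :> R.
Proof.
move=> n0 leNn inj.
have vinj : injective (vertex c) by move=> [i s] [j t] [<-] /= /inj ->.
pose A := [set vertex c j | j : 'I_k * 'I_N]%SET.
(* Only the values on [A] are prescribed; [v.2] is a default elsewhere. *)
pose nxt v := if [pick j | vertex c j == v] is Some j then next_entry c j else v.2.
have nxtE j : nxt (vertex c j) = next_entry c j.
  rewrite /nxt; case: pickP => [j' /eqP/vinj -> //|/(_ j)].
  by rewrite eqxx.
rewrite -(@count_absorbed _ _ _ _ A nxt) //; last first.
  move=> i; rewrite -[RHS](card_ord N) -(card_codom (inj i)).
  apply: eq_card => a; rewrite inE; apply/imsetP/codomP => [[[i' t] _ [-> ->]]|[t ->]].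
    by exists t.
  by exists (i, t).
congr (_ %:R); apply: eq_card => h; rewrite !inE /traced_by.
have -> : [forall i, injectiveb (c i)] by apply/forallP=> i; apply/injectiveP.
rewrite andTb; congr (_ && _).
  apply/forallP/forall_inP => [H _ /imsetP[j _ ->]|H j].
    by rewrite nxtE.
  by rewrite -nxtE H ?imset_f.
apply: eq_forallb => v; apply/existsP/exists_inP => [[j cj]|[_ /imsetP[j _ ->] cj]].
  by exists (vertex c j); rewrite ?imset_f.
by exists j.
Qed.

Lemma card_code :
  #|[set c : {ffun 'I_k -> {ffun 'I_N -> 'I_n}} | [forall i, injectiveb (c i)]]%SET| = ((n ^_ N) ^ k)%N.
Proof.
have <- : #|@ffun_on_mem 'I_k _ (mem [set f : {ffun 'I_N -> 'I_n} | injectiveb f])| = ((n ^_ N) ^ k)%N.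
  by rewrite card_ffun_on card_inj_ffuns !card_ord.
apply: eq_card => c; rewrite inE; apply/forallP/ffun_onP => H i; have := H i; by rewrite inE.
Qed.

Lemma sum_cycle_points (R : numFieldType) : (0 < n)%N -> (N <= n)%N ->
  (\sum_h #|[set a | cycle_point (return_map h) N a]%SET|)%:R
  = ((n ^_ N) ^ k)%:R * (n%:R ^+ (k * (n - N)) * (1 - (1 - N%:R / n%:R) ^+ k)) :> R.
Proof.
move=> n0 leNn.
transitivity (\sum_c #|[set h | traced_by h c]%SET|%:R : R).
  rewrite -natr_sum; congr _%:R.
  transitivity (\sum_h \sum_(c | traced_by h c) 1)%N.
    apply: eq_bigr => h _; rewrite -card_traced -sum1_card.
    by apply: eq_bigl => c; rewrite inE.
  rewrite (exchange_big_dep predT) //=; apply: eq_bigr => c _.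
  by rewrite -sum1_card; apply: eq_bigl => h; rewrite inE.
rewrite (bigID (fun c => [forall i, injectiveb (c i)])) /= [X in _ + X]big1 ?addr0; last first.
  move=> c /negPf nc; apply/eqP; rewrite pnatr_eq0 cards_eq0; apply/eqP/setP=> h.
  by rewrite !inE /traced_by nc.
rewrite -card_code mulr_natl -sumr_const.
apply: eq_big => c; rewrite ?inE // => /forallP inj.
by apply: card_traced_code => // i; apply/injectiveP.
Qed.

End Codes.

Local Open Scope ring_scope.

Lemma cycle_point_conj (T T' : finType) (g : T -> T) (g' : T' -> T') (e : T -> T') N x :
  bijective e -> (forall y, e (g y) = g' (e y)) ->
  cycle_point g N x = cycle_point g' N (e x).
Proof.
move=> [e' eK e'K] conj; have inj := can_inj eK.
have it m y : e (iter m g y) = iter m g' (e y) by elim: m => //= m <-.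
rewrite /cycle_point -it (inj_eq inj); congr [&& _, _ & _].
  by rewrite -(map_inj_uniq inj); congr uniq; elim: N x => //= N IHN x; rewrite IHN conj.
apply/forallP/forallP=> conn y.
  by rewrite -(e'K y) -(iter_findex (conn (e' y))) it fconnect_iter.
have := iter_findex (conn (e y)); rewrite -it => /inj <-; exact: fconnect_iter.
Qed.

(** * From maps on ['I_k * 'I_n] to tuples of functions between arbitrary sets *)

Section Transport.
Variables (k n : nat) (k0 : (0 < k)%N) (X : 'I_k -> finType) (hX : forall i, #|X i| = n).

Definition number i (x : X i) : 'I_n := cast_ord (hX i) (enum_rank x).
Definition unnumber i (a : 'I_n) : X i := enum_val (cast_ord (esym (hX i)) a).

Lemma numberK i : cancel (@number i) (@unnumber i).
Proof. by move=> x; rewrite /unnumber /number cast_ordK enum_rankK. Qed.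

Lemma unnumberK i : cancel (@unnumber i) (@number i).
Proof. by move=> a; rewrite /unnumber /number enum_valK cast_ordKV. Qed.

Definition decode (h : {ffun 'I_k * 'I_n -> 'I_n}) : fun_tuple X :=
  [ffun i => [ffun x : X i => unnumber (ordS i) (h (i, number x))]].

Definition encode (f : fun_tuple X) : {ffun 'I_k * 'I_n -> 'I_n} :=
  [ffun v => number (f v.1 (unnumber v.1 v.2))].

Lemma decode_bij : bijective decode.
Proof.
exists encode => [h|f].
  by apply/ffunP=> -[i a]; rewrite !ffunE /= unnumberK unnumberK.
apply/ffunP=> i; rewrite ffunE; apply/ffunP=> x.
by rewrite !ffunE /= !numberK.
Qed.

Lemma number_round_trip h (x : X (Ordinal k0)) :
  number (round_trip (decode h) x) = return_map k0 h (number x).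
Proof.
(* The cast closing [round_trip] changes the fibre index only along an equality, so numbering does
   not see it. *)
have castE i j (E : i = j) (y : X i) : number (ecast l (X l) E y) = number y.
  by case: _ / E.
have pE m : (iter m (@ordS k) (Ordinal k0), number (partial_comp (decode h) m x))
    = iter m (step h) (Ordinal k0, number x).
  by elim: m => // m IHm; rewrite [RHS]iterS -IHm /step /= !ffunE unnumberK.
by rewrite /return_map -pE /= /round_trip castE.
Qed.

Lemma card_fun_tuple : #|{: fun_tuple X}| = (n ^ (k * n))%N.
Proof. by rewrite -(bij_eq_card decode_bij) card_ffun card_prod !card_ord. Qed.

(** Each eventually [N]-cyclic tuple contributes its [N] cycle points to [sum_cycle_points] and any
    other tuple contributes none; hence the factor [N]. *)
Lemma count_eventually_cyclic (R : numFieldType) N : (0 < N)%N -> (0 < n)%N -> (N <= n)%N ->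
  N%:R * #|[set f : fun_tuple X | `[< eventually_cyclic k0 N f >]]%SET|%:R
  = ((n ^_ N) ^ k)%:R * (n%:R ^+ (k * (n - N)) * (1 - (1 - N%:R / n%:R) ^+ k)) :> R.
Proof.
move=> N0 n0 leNn; rewrite -(sum_cycle_points k0) // -natrM -sum1_card big_distrr /=.
congr _%:R; rewrite (reindex decode) /=; last exact/onW_bij/decode_bij.
rewrite big_mkcond; apply: eq_bigr => h _; rewrite inE muln1.
have -> : #|[set a | cycle_point (return_map k0 h) N a]%SET|
        = #|[set x | cycle_point (@round_trip k X (decode h) (Ordinal k0)) N x]%SET|.
  have bij := Bijective (@numberK (Ordinal k0)) (@unnumberK (Ordinal k0)).
  rewrite -(card_imset _ (bij_inj bij)); apply: eq_card => a; rewrite inE.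
  apply/idP/imsetP => [cp|[x]].
    exists (unnumber _ a); rewrite ?unnumberK // inE.
    by rewrite (cycle_point_conj _ _ bij (@number_round_trip h)) unnumberK.
  by rewrite inE => + ->; rewrite (cycle_point_conj _ _ bij (@number_round_trip h)).
case: asboolP => [/map_eventually_cyclic_card -> //|nev].
apply/esym/eqP; rewrite cards_eq0; apply/eqP/setP=> x; rewrite !inE.
by apply/negP=> /(cycle_point_eventually N0).
Qed.

Lemma prob_eventually_cyclicE (R : realType) N : (0 < N)%N -> (N <= n)%N ->
  prob_eventually_cyclic R k0 X N =
    N%:R^-1 * n%:R ^- (k * (N - 1))
    * ((n - 1)`!%:R / (n - N)`!%:R) ^+ k
    * (1 - (1 - N%:R / n%:R) ^+ k).
Proof.
move=> N0 leNn; have n0 : (0 < n)%N by apply: leq_trans leNn.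
have nn0 : n%:R != 0 :> R by rewrite pnatr_eq0 -lt0n.
have Nn0 : N%:R != 0 :> R by rewrite pnatr_eq0 -lt0n.
rewrite /prob_eventually_cyclic card_fun_tuple; set c := #|_|%:R.
have -> : c = N%:R^-1 * (N%:R * c) by rewrite mulKf.
rewrite count_eventually_cyclic //.
have -> : ((n ^_ N) ^ k)%:R = n%:R ^+ k * ((n - 1)`!%:R / (n - N)`!%:R) ^+ k :> R.
  rewrite natrX -exprMn; congr (_ ^+ k); rewrite mulrA; apply: (canRL (mulfK _)).
    by rewrite pnatr_eq0 -lt0n fact_gt0.
  by rewrite -!natrM ffact_fact // -{1}(prednK n0) factS prednK // subn1.
(* Splits [k * n] as [k * (n - N) + k * (N - 1) + k]; the truncated subtractions are exact because
   [1 <= N <= n]. *)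
have -> : (n ^ (k * n))%:R = n%:R ^+ (k * (n - N)) * n%:R ^+ (k * (N - 1)) * n%:R ^+ k :> R.
  by rewrite natrX -!exprD; congr (_ ^+ _); nia.
set q := 1 - _ ^+ k; set F := (_ / _) ^+ k.
have a0 := expf_neq0 (k * (n - N)) nn0; have b0 := expf_neq0 (k * (N - 1)) nn0.
have m0 := expf_neq0 k nn0.
move: (_ ^+ (k * (n - N))) (_ ^+ (k * (N - 1))) (n%:R ^+ k) a0 b0 m0 => a b m a0 b0 m0.
by field; rewrite Nn0 a0 b0 m0.
Qed.

End Transport.

(* As a function of [x = 1 / n] the probability is a polynomial [P] with *)
(* [P 0 = 0] and [P' 0 = k]. *)
Definition prob_poly (R : realType) (k N : nat) : {poly R} :=
  N%:R^-1 *: ((\prod_(i < N.-1) (1 - i.+1%:R *: 'X)) ^+ k * (1 - (1 - N%:R *: 'X) ^+ k)).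

(** * Behaviour of the probability as a polynomial in [1 / n] *)

Lemma prob_polyE (R : realType) (k N n : nat) : (0 < N)%N -> (N <= n)%N ->
  (prob_poly R k N).[n%:R^-1] =
    N%:R^-1 * n%:R ^- (k * (N - 1))
    * ((n - 1)`!%:R / (n - N)`!%:R) ^+ k
    * (1 - (1 - N%:R / n%:R) ^+ k).
Proof.
move=> N0 leNn; have n0 : (0 < n)%N by apply: leq_trans leNn.
have nn0 : n%:R != 0 :> R by rewrite pnatr_eq0 -lt0n.
rewrite /prob_poly !hornerE /=; congr (_ * _); rewrite -[RHS]mulrA; congr (_ * _).
rewrite mulnC exprM -exprVn -exprMn; congr (_ ^+ k).
(* The quotient is a falling factorial with [N - 1] factors; dividing each by [n] gives the factors
   [1 - (i + 1) / n] of [prob_poly]. *)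
have -> : (n - 1)`!%:R / (n - N)`!%:R = ((n - 1) ^_ (N - 1))%:R :> R.
  apply: (canLR (mulfK _)); first by rewrite pnatr_eq0 -lt0n fact_gt0.
  rewrite -natrM -(ffact_fact (leq_sub2r 1 leNn)).
  by congr (_ * _`!)%:R; lia.
rewrite ffact_prod natr_prod horner_prod subn1.
have -> : n%:R ^- N.-1 = \prod_(i < N.-1) n%:R^-1 :> R by rewrite -exprVn prodr_const card_ord.
rewrite -big_split /=.
apply: eq_bigr => i _; rewrite !hornerE natrB; last by have := ltn_ord i; lia.
rewrite natrB // -[i.+1]addn1 natrD; field.
exact: nn0.
Qed.

(** The factor [1 - (1 - N X) ^ k] vanishes at 0 with derivative [k * N] there, and the other
    product is 1 at 0; the prefactor [1 / N] leaves [k]. *)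
Lemma prob_poly_expansion (R : realType) (k N : nat) : (0 < N)%N ->
  prob_poly R k N = k%:R *: 'X + drop_poly 2 (prob_poly R k N) * 'X^2.
Proof.
move=> N0; have Nn0 : N%:R != 0 :> R by rewrite pnatr_eq0 -lt0n.
rewrite -{1}[prob_poly R k N](poly_take_drop 2); congr (_ + _).
have prod0 : (\prod_(i < N.-1) (1 - i.+1%:R *: 'X) : {poly R}).[0] = 1.
  by rewrite horner_prod big1 // => i _; rewrite !hornerE ?mulr0 ?subr0.
have P0 : (prob_poly R k N)`_0 = 0.
  by rewrite -horner_coef0 /prob_poly !hornerE ?(mulr0, subr0, expr1n, subrr) /= mulr0.
have deriv1 : (1 : {poly R})^`() = 0 by rewrite -polyC1 derivC.
have P1 : (prob_poly R k N)`_1 = k%:R.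
  rewrite -[LHS]mulr1n -coef_deriv -horner_coef0 /prob_poly.
  rewrite derivZ derivM !(derivD, derivN, deriv_exp, derivZ, derivX) !deriv1 ?(add0r, oppr0).
  rewrite !hornerE prod0 ?(mulr0, mulr1, subr0, add0r, expr1n, subrr, mul1r) /=.
  rewrite hornerMn !hornerE ?(mulr0, subr0, expr1n, mulr1) -mulr_natl.
  by field.
apply/polyP=> i; rewrite coef_take_poly coefZ coefX.
by case: i => [|[|i]] //=; rewrite ?P0 ?P1 ?mulr0 ?mulr1.
Qed.

Lemma ler_horner_sum_coef (R : realType) (p : {poly R}) (x : R) :
  `|x| <= 1 -> `|p.[x]| <= \sum_(i < size p) `|p`_i|.
Proof.
move=> x1; rewrite horner_coef (le_trans (ler_norm_sum _ _ _)) // ler_sum // => i _.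
by rewrite normrM normrX ler_piMr // exprn_ile1.
Qed.

Local Open Scope classical_set_scope.

Theorem corollary4p8 (R : realType) (k N : nat) (hk : (0 < k)%N) (hN : (0 < N)%N)
    (X : nat -> 'I_k -> finType) (hX : forall (n : nat) (i : 'I_k), #|X n i| = n) :
  (forall n : nat, (N.+1 <= n)%N ->
     prob_eventually_cyclic R hk (X n) N =
       N%:R^-1 * n%:R ^- (k * (N - 1))
       * ((n - 1)`!%:R / (n - N)`!%:R) ^+ k
       * (1 - (1 - N%:R / n%:R) ^+ k))
  /\ (fun n : nat => prob_eventually_cyclic R hk (X n) N : R^o) =
       (fun n : nat => k%:R / n%:R : R^o) +O_\oo (fun n : nat => 1 / n%:R ^+ 2 : R^o).
Proof.
have probE n : (N <= n)%N -> prob_eventually_cyclic R hk (X n) N =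
       N%:R^-1 * n%:R ^- (k * (N - 1))
       * ((n - 1)`!%:R / (n - N)`!%:R) ^+ k
       * (1 - (1 - N%:R / n%:R) ^+ k).
  exact: prob_eventually_cyclicE (hX n) _ _ hN.
split=> [n /ltnW/probE //|].
apply/eqaddOP; near=> M; exists N => // n /= leNn.
rewrite -[(_ - _) n]/(prob_eventually_cyclic R hk (X n) N - k%:R / n%:R).
rewrite probE // -prob_polyE // {1}(prob_poly_expansion _ _ hN) !hornerE addrC addKr /=.
rewrite -mulrA -invfM -expr2 normrM.
rewrite ler_pM //.
(* Since [1 / n <= 1], the cofactor of [1 / n ^ 2] is bounded by the sum of the absolute values of
   its coefficients, which is free of [n]; any [M] above that sum works. *)
apply: le_trans (ler_horner_sum_coef _ _) _.
  have n0 : (0 < n)%N by apply: leq_trans leNn.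
  by rewrite normfV normr_nat invf_le1 ?ltr0n ?ler1n.
near: M; apply: nbhs_pinfty_ge; exact: num_real.
Unshelve. all: by end_near. Qed.
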